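(* Let $\lambda$ be the unital $*$-endomorphism of $\mathcal{O}_2$ (with generators $S_0,S_1$) given by \[ \lambda(S_0)=\tfrac{1}{\sqrt2}(S_0+S_1),\qquad \lambda(S_1)=\tfrac{1}{\sqrt2}\left(S_0S_0S_0^*+S_1S_1S_1^*-S_1S_0S_0^*-S_0S_1S_1^*\right). \] Its associated unitary $\lambda(S_0)S_0^*+\lambda(S_1)S_1^*$ lies in $\mathcal{F}_2^2$, and $\lambda$ does not leave any standard MASA of $\mathcal{O}_2$ invariant: there is no unitary $z\in\mathcal{F}_2^1$ such that $\lambda(\lambda_z(\mathcal{D}_2))\subseteq\lambda_z(\mathcal{D}_2)$.
   Context: $\mathcal{O}_2$ is the Cuntz algebra generated by isometries $S_0,S_1$ with $S_0S_0^*+S_1S_1^*=I$. For a word $\alpha=(\alpha_1,\ldots,\alpha_k)\in\{0,1\}^k$ put $S_\alpha=S_{\alpha_1}\cdots S_{\alpha_k}$. $\mathcal{F}_2^k$ is the span of $S_\alpha S_\beta^*$ with $\alpha,\beta\in\{0,1\}^k$, and $\mathcal{D}_2$ is the $C^*$-subalgebra generated by all projections $S_\alpha S_\alpha^*$ over all words $\alpha$. For a unitary $u\in\mathcal{O}_2$, $\lambda_u$ is the unital $*$-endomorphism of $\mathcal{O}_2$ determined by $\lambda_u(S_i)=uS_i$, $i=0,1$. A standard MASA of $\mathcal{O}_2$ is a subalgebra of the form $\lambda_z(\mathcal{D}_2)$ with $z$ a unitary in $\mathcal{F}_2^1$. *)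

(* Defs.v *)
From HB Require Import structures.
From mathcomp Require Import all_boot all_order all_algebra.
From mathcomp Require Import complex.
From mathcomp Require Import all_classical all_reals.
Set Implicit Arguments.
Unset Strict Implicit.
Unset Printing Implicit Defensive.
Import Order.TTheory GRing.Theory Num.Theory.
Local Open Scope classical_set_scope.
Local Open Scope ring_scope.

(* A Banach *-algebra satisfying the C*-identity, spelled out with a real-valued
   norm: the normed modules of the library cannot be joined with its algebra
   structures, since numDomainType already is the join of rings and normed
   groups. Nonnegativity of the norm follows from the axioms. *)
HB.mixin Record isCStarAlgebra (R : realType) A of GRing.Algebra R[i] A := {
  cnorm : A -> R;
  cnorm0_eq0 : forall x : A, cnorm x = 0 -> x = 0;
  cnormZ : forall (c : R[i]) (x : A), cnorm (c *: x) = Normc.normc c * cnorm x;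
  ler_cnormD : forall x y : A, cnorm (x + y) <= cnorm x + cnorm y;
  ler_cnormM : forall x y : A, cnorm (x * y) <= cnorm x * cnorm y;
  cnorm_complete : forall x_ : nat -> A,
    (forall e : R, 0 < e -> exists N : nat, forall m n : nat,
       (N <= m)%N -> (N <= n)%N -> cnorm (x_ m - x_ n) < e) ->
    exists l : A, forall e : R, 0 < e -> exists N : nat, forall n : nat,
       (N <= n)%N -> cnorm (x_ n - l) < e;
  star : A -> A;
  starK : involutive star;
  starD : forall x y : A, star (x + y) = star x + star y;
  starZ : forall (c : R[i]) (x : A), star (c *: x) = conjc c *: star x;
  starM : forall x y : A, star (x * y) = star y * star x;
  cnorm_star : forall x : A, cnorm (star x * x) = cnorm x ^+ 2
}.

(* The unit belongs to the structure, and algType requires 1 != 0. *)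
#[short(type="cstarAlgType")]
HB.structure Definition CStarAlgebra (R : realType) :=
  { A of GRing.Algebra R[i] A & isCStarAlgebra R A }.

(* Linearity over R[i], multiplicativity and unitality are part of
   {lrmorphism A -> B}. *)
Definition star_morphism (R : realType) (A B : cstarAlgType R)
    (f : {lrmorphism A -> B}) : Prop :=
  forall x, f (star x) = star (f x).

Definition unitary (R : realType) (A : cstarAlgType R) (u : A) : Prop :=
  star u * u = 1 /\ u * star u = 1.

Definition cnorm_closed (R : realType) (A : cstarAlgType R) (M : set A) : Prop :=
  forall x : A, (forall e : R, 0 < e -> exists2 y, M y & cnorm (x - y) < e) -> M x.

Definition cstar_subalg (R : realType) (A : cstarAlgType R) (M : set A) : Prop :=
  [/\ cnorm_closed M, M 0,
      forall (c : R[i]) x y, M x -> M y -> M (c *: x + y),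
      forall x y, M x -> M y -> M (x * y)
    & forall x, M x -> M (star x)].

Definition cstar_generated (R : realType) (A : cstarAlgType R) (G : set A) :
  set A := smallest (@cstar_subalg R A) G.

Definition cuntz_relations (R : realType) (A : cstarAlgType R) (S : 'I_2 -> A) :
    Prop :=
  (forall i, star (S i) * S i = 1) /\ \sum_i S i * star (S i) = 1.

(* (A, S) is the Cuntz algebra O_2 with its canonical generators: the universal
   unital C*-algebra generated by two isometries subject to the relation above. *)
Record cuntz_algebra (R : realType) (A : cstarAlgType R) (S : 'I_2 -> A) :
    Prop := CuntzAlgebra {
  cuntz_rel : cuntz_relations S;
  cuntz_gen : cstar_generated (range S) = setT;
  cuntz_univ : forall (B : cstarAlgType R) (T : 'I_2 -> B), cuntz_relations T ->
    exists f : {lrmorphism A -> B}, star_morphism f /\ forall i, f (S i) = T i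
}.

Definition cuntz_word (R : realType) (A : cstarAlgType R) (S : 'I_2 -> A)
  (w : seq 'I_2) : A := \prod_(i <- w) S i.

Definition cuntz_F (R : realType) (A : cstarAlgType R) (S : 'I_2 -> A) (k : nat) :
    set A :=
  [set x | exists c : k.-tuple 'I_2 -> k.-tuple 'I_2 -> R[i],
     x = \sum_a \sum_b c a b *: (cuntz_word S a * star (cuntz_word S b))].

Definition cuntz_D (R : realType) (A : cstarAlgType R) (S : 'I_2 -> A) : set A :=
  cstar_generated
    (range (fun w : seq 'I_2 => cuntz_word S w * star (cuntz_word S w))).

Lemma cuntz_endo_subproof (R : realType) (A : cstarAlgType R) (S : 'I_2 -> A)
    (hS : cuntz_algebra S) (u : A) (hu : unitary u) :
  exists f : {lrmorphism A -> A},
    star_morphism f /\ forall i, f (S i) = u * S i.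
Proof.
case: hu => uu' u'u; case: (cuntz_rel hS) => SS SS1.
apply: (cuntz_univ hS); split=> [i|].
  by rewrite starM -mulrA (mulrA (star u)) uu' mul1r SS.
rewrite (eq_bigr (fun i => u * (S i * star (S i)) * star u)).
  by rewrite -mulr_suml -mulr_sumr SS1 mulr1.
by move=> i _; rewrite starM !mulrA.
Qed.

(* The endomorphism lambda_u. The choice is immaterial: *-morphisms between
   C*-algebras are continuous, so their values on the generators determine them. *)
Definition cuntz_endo (R : realType) (A : cstarAlgType R) (S : 'I_2 -> A)
    (hS : cuntz_algebra S) (u : A) (hu : unitary u) : {lrmorphism A -> A} :=
  projT1 (cid (cuntz_endo_subproof hS hu)).

Lemma cuntz_endoP (R : realType) (A : cstarAlgType R) (S : 'I_2 -> A)
    (hS : cuntz_algebra S) (u : A) (hu : unitary u) :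
  star_morphism (cuntz_endo hS hu) /\ forall i, cuntz_endo hS hu (S i) = u * S i.
Proof. exact: projT2 (cid (cuntz_endo_subproof hS hu)). Qed.

Definition standard_masa (R : realType) (A : cstarAlgType R) (S : 'I_2 -> A)
    (hS : cuntz_algebra S) (M : set A) : Prop :=
  exists (z : A) (hz : unitary z),
    cuntz_F S 1 z /\ M = cuntz_endo hS hz @` cuntz_D S.

Definition masa_endo_spec (R : realType) (A : cstarAlgType R) (S : 'I_2 -> A)
    (lam : {lrmorphism A -> A}) : Prop :=
  [/\ star_morphism lam,
      lam (S 0) = (sqrtC 2)^-1 *: (S 0 + S 1)
    & lam (S 1) = (sqrtC 2)^-1 *:
        (S 0 * S 0 * star (S 0) + S 1 * S 1 * star (S 1)
         - S 1 * S 0 * star (S 0) - S 0 * S 1 * star (S 1))].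

(* Main.v *)
Require Import Defs.
From mathcomp Require Import all_boot all_order all_algebra.
From mathcomp Require Import complex.
From mathcomp Require Import all_classical all_reals.
From mathcomp Require Import ring.
Import Order.TTheory GRing.Theory Num.Theory.
Local Open Scope classical_set_scope.
Local Open Scope ring_scope.

(** Put [T0 = z S0 = a S0 + b S1], a unit vector of the span of the generators,
    [P = T0 T0^*] and [Q_i = S_i S_i^* ] for [i = 0, 1]. Because
    [lambda(S1) = (S0 - S1) (Q_0 - Q_1) / sqrt 2], one finds
    [lambda(P) = g+ Q_0 g+^* + g- Q_1 g-^*], where [g+] and [g-] have
    coordinates [(a, b)] and [(a, -b)] in the basis [(S0 + S1) / sqrt 2],
    [(S0 - S1) / sqrt 2]. An invariant standard MASA would be a commutative
    algebra containing [lambda(P)], [P] and [T0 P T0^*].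
    Commutation with [P] makes [g-] orthogonal or parallel to [T0]; as
    [<g-, T0>] has nonzero real part it is parallel, which means
    [a^2 + b^2 = 0], and then [g+] is orthogonal to [T0]. So
    [T0^* lambda(P) T0] is a nonzero multiple of [Q_1], and commutation of
    [lambda(P)] with [T0 P T0^*] forces it to commute with [P], which is false
    because [a] and [b] are nonzero. *)

Lemma sum_ord2 {V : nmodType} (F : 'I_2 -> V) : \sum_i F i = F 0 + F 1.
Proof.
rewrite big_ord_recl big_ord1; congr (F _ + F _); exact: val_inj.
Qed.

Lemma ord2P (i : 'I_2) : i = 0 \/ i = 1.
Proof.
by case: i => [[|[|]]] // i2; [left|right]; exact: val_inj.
Qed.

(** * Elementary C*-algebra facts and commutants *)

Section CStar.
Context {R : realType} {A : cstarAlgType R}.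
Implicit Types (x y p : A) (c : R[i]).

Lemma star0 : star (0 : A) = 0.
Proof. by rewrite -[X in star X](scale0r (0 : A)) starZ conjc0 scale0r. Qed.

Lemma star1 : star (1 : A) = 1.
Proof. by rewrite -[LHS]mulr1 -[X in _ * X]starK -starM mulr1 starK. Qed.

Lemma starN x : star (- x) = - star x.
Proof. by apply/eqP; rewrite -addr_eq0 -starD addNr star0. Qed.

Lemma starB x y : star (x - y) = star x - star y.
Proof. by rewrite starD starN. Qed.

Lemma cnormN x : cnorm (- x) = cnorm x.
Proof.
have N1 : Normc.normc (-1 : R[i]) = 1.
  by rewrite /= oppr0 expr0n addr0 sqrrN expr1n sqrtr1.
by rewrite -scaleN1r cnormZ N1 mul1r.
Qed.

Lemma cnorm0 : cnorm (0 : A) = 0.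
Proof.
by rewrite -[X in cnorm X](scale0r (0 : A)) cnormZ Normc.normc0 mul0r.
Qed.

Lemma cnorm_ge0 x : 0 <= cnorm x.
Proof.
rewrite -(pmulrn_lge0 _ (isT : (0 < 2)%N)) -cnorm0 -(subrr x) mulr2n.
by rewrite -{2}(cnormN x) ler_cnormD.
Qed.

(** Closedness holds because [x p - p x = (x - y) p - p (x - y)] for [y] commuting with [p], which
    is small when [x - y] is. Stability under [star] comes from [star p = p]. *)
Lemma commutant_cstar_subalg p :
  star p = p -> cstar_subalg [set x : A | x * p = p * x].
Proof.
move=> pp; split => /= [x xP||c x y xp yp|x y xp yp|x xp].
- apply/eqP; rewrite -subr_eq0; apply/eqP/cnorm0_eq0/eqP.
  rewrite eq_le cnorm_ge0 andbT; apply/ler_addgt0Pr => e e0; rewrite add0r.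
  (* The added 1 keeps the divisor positive when [p = 0]. *)
  have k0 : 0 < cnorm p + cnorm p + 1.
    by rewrite ltr_wpDl ?addr_ge0 ?cnorm_ge0.
  have [y /= yp /ltW xy] := xP _ (divr_gt0 e0 k0).
  have -> : x * p - p * x = (x - y) * p - p * (x - y).
    by rewrite mulrBl mulrBr yp opprB addrA subrK.
  apply: (le_trans (ler_cnormD _ _)); rewrite cnormN.
  apply: (le_trans (lerD (ler_cnormM _ _) (ler_cnormM _ _))).
  rewrite [cnorm p * _]mulrC -mulrDr.
  apply: (@le_trans _ _ (cnorm (x - y) * (cnorm p + cnorm p + 1))).
    by rewrite ler_wpM2l ?cnorm_ge0 ?lerDl.
  by rewrite -ler_pdivlMr.
- by rewrite mul0r mulr0.
- by rewrite mulrDl mulrDr -scalerAl -scalerAr xp yp.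
- by rewrite -mulrA yp mulrA xp mulrA.
- by rewrite -{1}pp -starM -xp starM pp.
Qed.

End CStar.

(** * Word projections and vectors in the span of the generators *)

Definition cuntz_vec {R : realType} {A : cstarAlgType R} (S : 'I_2 -> A)
  (a b : R[i]) : A := a *: S 0 + b *: S 1.

(** The inner product of the pairs [(a, b)] and [(c, d)], conjugate-linear in the first. *)
Definition cdot {R : realType} (a b c d : R[i]) : R[i] :=
  conjc a * c + conjc b * d.

Section Cuntz.
Context {R : realType} {A : cstarAlgType R} (S : 'I_2 -> A).
Hypothesis SP : cuntz_relations S.

Lemma cuntz_sum1 : S 0 * star (S 0) + S 1 * star (S 1) = 1.
Proof. by have := SP.2; rewrite sum_ord2. Qed.

Lemma cuntz_starM i j : star (S i) * S j = (i == j)%:R.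
Proof.
have ortho : star (S 0) * S 1 = 0.
  have := congr1 ( *%R (star (S 0))) cuntz_sum1.
  rewrite mulrDr mulr1 mulrA SP.1 mul1r -[RHS]addr0 => /addrI.
  move=> /(congr1 ( *%R^~ (S 1))).
  by rewrite mul0r -!mulrA SP.1 mulr1.
have [->|] := eqVneq i j; first by rewrite SP.1.
case: (ord2P i) (ord2P j) => -> [] -> //.
by rewrite -[S 0]starK -starM ortho star0.
Qed.

Lemma cuntz_word_cons i w : cuntz_word S (i :: w) = S i * cuntz_word S w.
Proof. by rewrite /cuntz_word big_cons. Qed.

(** Different first letters make both products zero; a common first letter [j] conjugates the
    products for the tails by [S j]. *)
Lemma cuntz_word_proj_comm v w :
  let p u := cuntz_word S u * star (cuntz_word S u) in p v * p w = p w * p v.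
Proof.
elim: v w => [|i v IH] [|j w] /=; rewrite ?[cuntz_word S [::]]big_nil
  ?star1 ?mul1r ?mulr1 //.
rewrite !cuntz_word_cons !starM !mulrA.
rewrite -!(mulrA _ (star (S _)) (S _)) !cuntz_starM (eq_sym j).
case: eqP => [->|_]; rewrite ?(mulr0, mul0r) // !mulr1.
pose p u := cuntz_word S u * star (cuntz_word S u).
transitivity (S j * (p v * p w) * star (S j)); first by rewrite /p !mulrA.
by rewrite /p IH !mulrA.
Qed.

(** The commutant of a word projection is a C*-subalgebra containing all generators of [cuntz_D S],
    hence all of it. *)
Lemma cuntz_D_comm d w : cuntz_D S d ->
  let p := cuntz_word S w * star (cuntz_word S w) in d * p = p * d.
Proof.
move=> Dd /=; set p := _ * star _.
apply: (Dd [set x | x * p = p * x]); split.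
  by apply: commutant_cstar_subalg; rewrite starM starK.
by move=> _ [v _ <-]; exact: cuntz_word_proj_comm.
Qed.

Lemma star_cuntz_vecM a b c d :
  star (cuntz_vec S a b) * cuntz_vec S c d = (cdot a b c d)%:A.
Proof.
rewrite /cuntz_vec starD !starZ mulrDl !mulrDr -!scalerAl -!scalerAr.
by rewrite !cuntz_starM !scaler0 addr0 add0r !scalerA -scalerDl.
Qed.


Lemma cuntz_gen_vec : (S 0 = cuntz_vec S 1 0) * (S 1 = cuntz_vec S 0 1).
Proof. by rewrite /cuntz_vec !scale1r !scale0r addr0 add0r. Qed.

Lemma cuntz_F_word k (v w : k.-tuple 'I_2) :
  cuntz_F S k (cuntz_word S v * star (cuntz_word S w)).
Proof.
exists (fun a b => ((a == v) && (b == w))%:R).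
rewrite (bigD1 v) //= (bigD1 w) //= !eqxx scale1r.
rewrite big1 ?addr0 => [|b /negPf ->]; last by rewrite andbF scale0r.
rewrite big1 ?addr0 // => a /negPf av.
by rewrite big1 // => b _; rewrite av scale0r.
Qed.

Lemma cuntz_F_lin k (c : R[i]) x y :
  cuntz_F S k x -> cuntz_F S k y -> cuntz_F S k (c *: x + y).
Proof.
move=> [cx ->] [cy ->]; exists (fun a b => c * cx a b + cy a b).
rewrite scaler_sumr -big_split /=; apply: eq_bigr => a _.
rewrite scaler_sumr -big_split /=; apply: eq_bigr => b _.
by rewrite scalerA scalerDl.
Qed.

Lemma cuntz_F1_gen z i : cuntz_F S 1 z -> exists a b, z * S i = cuntz_vec S a b.
Proof.
move=> [c ->]; rewrite mulr_suml.
pose P x := exists a b : R[i], x = cuntz_vec S a b.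
have P0 : P 0 by exists 0, 0; rewrite /cuntz_vec !scale0r addr0.
have PD x y : P x -> P y -> P (x + y).
  move=> [a [b ->]] [a' [b' ->]]; exists (a + a'), (b + b').
  by rewrite /cuntz_vec !scalerDl addrACA.
apply: (big_ind P) => // v _; rewrite mulr_suml; apply: (big_ind P) => // w _.
rewrite -scalerAl -mulrA; case/tupleP: v => j v; case/tupleP: w => k w.
rewrite (tuple0 v) (tuple0 w) /cuntz_word !big_cons !big_nil !mulr1.
rewrite cuntz_starM; move: (c _ _) => c0.
case: (k == i); last by rewrite mulr0 scaler0.
rewrite mulr1; case: (ord2P j) => ->; [exists c0, 0 | exists 0, c0];
  by rewrite /cuntz_vec scale0r ?addr0 ?add0r.
Qed.

(** Insert [1 = Q_0 + Q_1] between [f] and [star f]: only the values [f S_i] matter. With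
    [f = lambda(T0)] this gives the two terms of [lambda(P)]. *)
Lemma cuntz_conj_split f g g' : f * S 0 = g * S 0 -> f * S 1 = g' * S 1 ->
  f * star f = g * (S 0 * star (S 0)) * star g
             + g' * (S 1 * star (S 1)) * star g'.
Proof.
move=> f0 f1; rewrite -{1}(mulr1 f) -cuntz_sum1 mulrDr mulrDl !mulrA f0 f1.
by rewrite -!mulrA -!starM f0 f1.
Qed.

(** Products [star v * v'] of vectors are scalars, so compressing [E] leaves a combination of [Q_0]
    and [Q_1]. *)
Lemma cuntz_compress a b c d x y x' y' E :
  E = cuntz_vec S x y * (S 0 * star (S 0)) * star (cuntz_vec S x y)
    + cuntz_vec S x' y' * (S 1 * star (S 1)) * star (cuntz_vec S x' y') ->
  star (cuntz_vec S a b) * E * cuntz_vec S c d =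
    (cdot a b x y * cdot x y c d) *: (S 0 * star (S 0))
  + (cdot a b x' y' * cdot x' y' c d) *: (S 1 * star (S 1)).
Proof.
have dotE v w v' w' q : star v * (v' * q * star w') * w =
  (star v * v') * q * (star w' * w) by rewrite !mulrA.
move=> ->; rewrite [star _ * (_ + _)]mulrDr mulrDl !dotE !star_cuntz_vecM.
rewrite -!scalerAl -!scalerAr !mul1r !mulr1 !scalerA.
by rewrite ![_ * cdot _ _ c d]mulrC.
Qed.

End Cuntz.

(** * Arithmetic of the coefficients *)

Lemma isqrt2 {R : realType} (h : R[i]) : h = (sqrtC 2)^-1 ->
  [/\ conjc h = h, h != 0 & h * h + h * h = 1].
Proof.
move=> ->; have s0 : sqrtC 2 != 0 :> R[i] by rewrite sqrtC_eq0 pnatr_eq0.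
split; first by apply: geC0_conj; rewrite invr_ge0 sqrtC_ge0 ler0n.
  by rewrite invr_eq0.
by rewrite -mulr2n -expr2 exprVn sqrtCK -[LHS]mulr_natr mulVf // pnatr_eq0.
Qed.

(* With [g+ = (h (a + b), h (a - b))] and [g- = (h (a - b), h (a + b))], the
   first equation expresses commutation with [P], the second one commutation
   with [T0 P T0^*]. *)
Lemma masa_coeff_absurd {R : realType} (a b h : R[i]) :
  conjc h = h -> h != 0 -> cdot a b a b = 1 ->
  cdot (- conjc b) (conjc a) (h * (a - b)) (h * (a + b))
    * cdot (h * (a - b)) (h * (a + b)) a b = 0 ->
  cdot a b (h * (a + b)) (h * (a - b)) * cdot (h * (a + b)) (h * (a - b)) a b
    * (a * conjc b) =
  cdot a b (h * (a - b)) (h * (a + b)) * cdot (h * (a - b)) (h * (a + b)) a b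
    * (a * conjc b) -> False.
Proof.
rewrite /cdot !(rmorphM, rmorphD, rmorphN) /= !conjcK => -> h0.
set a' := conjc a; set b' := conjc b => n1.
(* Here [c - d] is purely imaginary, so [c - d + 1] has real part 1. *)
have im (c d : R[i]) : conjc c = d -> c - d + 1 != 0.
  move=> cd; apply/negP => /eqP w.
  have w' : d - c + 1 = 0.
    have <- : conjc (c - d + 1) = 0 by rewrite w conjc0.
    by rewrite rmorphD rmorphB rmorph1 /= -cd conjcK.
  suff : (2 : R[i]) = 0 by move/eqP; rewrite pnatr_eq0.
  by rewrite -[RHS](addr0 0) -{1}w -w'; ring.
have w0 : a' * b - b' * a + 1 != 0.
  by apply: im; rewrite rmorphM /= conjcK mulrC.
have w0' : b' * a - a' * b + 1 != 0.
  by apply: im; rewrite rmorphM /= conjcK mulrC.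
move=> H1 H2.
(* The two factors of [H1] are [h (a^2 + b^2)] and [h (a' b - b' a + 1)]. *)
have ab : a * a + b * b = 0.
  apply: (mulIf w0); apply: (mulfI h0); apply: (mulfI h0).
  rewrite mul0r !mulr0 -[RHS]H1 -n1; ring.
have ab' : a' * a' + b' * b' = 0.
  by have := congr1 conjc ab; rewrite conjc0 rmorphD !rmorphM.
have bz : a = 0 -> False.
  move=> a0; move: n1 ab; rewrite a0 mulr0 mul0r !add0r => n1 /eqP.
  rewrite mulf_eq0 orbb => /eqP b0; move: n1; rewrite b0 mulr0 => /esym/eqP.
  by rewrite oner_eq0.
have az : b' = 0 -> False.
  move=> b0; apply: bz; move: ab'; rewrite b0 mulr0 addr0 => /eqP.
  rewrite mulf_eq0 orbb => /eqP a'0; by rewrite -(conjcK a) -/a' a'0 conjc0.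
(* The moduli of [a] and [b] agree: multiplying by [a' a + b' b = 1] turns the left side into a
   difference of products that [ab] and [ab'] kill. *)
have pq : a' * a - b' * b = 0.
  rewrite -[LHS]mulr1 -n1.
  transitivity ((a' * a' + b' * b') * (a * a) - b' * b' * (a * a + b * b)).
    ring.
  by rewrite ab ab'; ring.
(* The sum [a' b + b' a] is twice the real part of [a' b]; with [pq], its vanishing makes [g+]
   orthogonal to [T0]. *)
have Y : (a' * b + b' * a) * (a' * b + b' * a) = 0.
  transitivity ((a' * a' + b' * b') * (b * b) + b' * b' * (a * a + b * b)
     + 2 * b' * b * (a' * a - b' * b)); first ring.
  by rewrite ab ab' pq; ring.
move: Y => /eqP; rewrite mulf_eq0 orbb => /eqP Y.
have X : a' * (h * (a + b)) + b' * (h * (a - b)) = 0.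
  transitivity (h * (a' * a - b' * b + (a' * b + b' * a))); first ring.
  by rewrite pq Y; ring.
move: H2; rewrite X !mul0r => /esym/eqP.
rewrite !mulf_eq0 -!orbA.
have -> : a' * (h * (a - b)) + b' * (h * (a + b)) = h * (b' * a - a' * b + 1).
  by rewrite -n1; ring.
have -> : h * (a' - b') * a + h * (a' + b') * b = h * (a' * b - b' * a + 1).
  by rewrite -n1; ring.
rewrite !mulf_eq0 (negPf h0) (negPf w0) (negPf w0') /=.
by case/orP => /eqP.
Qed.

(** * The endomorphism and its associated unitary *)

Lemma cuntz_relations_unitary {R : realType} {A : cstarAlgType R}
    (S T : 'I_2 -> A) : cuntz_relations S -> cuntz_relations T ->
  unitary (T 0 * star (S 0) + T 1 * star (S 1)).
Proof.
have half (V W : 'I_2 -> A) : cuntz_relations V -> cuntz_relations W ->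
    (V 0 * star (W 0) + V 1 * star (W 1)) *
    star (V 0 * star (W 0) + V 1 * star (W 1)) = 1.
  move=> VP WP; rewrite starD !starM !starK mulrDl !mulrDr.
  have dotE v w v' w' : (v * star w) * (v' * w') = v * (star w * v') * w'.
    by rewrite !mulrA.
  rewrite !dotE !cuntz_starM //= !mulr0 !mul0r !mulr1 addr0 add0r.
  exact: cuntz_sum1.
move=> SP TP; split; last exact: half.
by have := half S T SP TP; rewrite !starD !starM !starK.
Qed.

Lemma star_morphism_relations {R : realType} {A B : cstarAlgType R}
    (S : 'I_2 -> A) (f : {lrmorphism A -> B}) :
  star_morphism f -> cuntz_relations S -> cuntz_relations (f \o S).
Proof.
move=> fs [S1 S2]; split=> [i|] /=; first by rewrite -fs -rmorphM S1 rmorph1.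
rewrite -(rmorph1 f) -S2 rmorph_sum.
by apply: eq_bigr => i _ /=; rewrite rmorphM /= fs.
Qed.

Lemma masa_S1_factor {R : realType} {A : cstarAlgType R} (S : 'I_2 -> A)
    (h : R[i]) :
  h *: (S 0 * S 0 * star (S 0) + S 1 * S 1 * star (S 1)
        - S 1 * S 0 * star (S 0) - S 0 * S 1 * star (S 1)) =
  cuntz_vec S h (- h) * (S 0 * star (S 0) - S 1 * star (S 1)).
Proof.
rewrite /cuntz_vec scaleNr -scalerBr -scalerAl; congr (_ *: _).
rewrite mulrBl !mulrBr !mulrA opprB [RHS]addrACA.
by rewrite [X in _ = _ + X]addrC addrA.
Qed.

(** With [V = Q_0 - Q_1], a self-adjoint unitary, [T 1] is [h (S 0 - S 1) V]. So [V] cancels from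
    both relations, leaving those of the rotated pair [h (S 0 + S 1)], [h (S 0 - S 1)]. *)
Lemma masa_relations {R : realType} {A : cstarAlgType R} (S : 'I_2 -> A)
    (T : 'I_2 -> A) (h := (sqrtC 2)^-1 : R[i]) :
  cuntz_relations S -> T 0 = h *: (S 0 + S 1) ->
  T 1 = h *: (S 0 * S 0 * star (S 0) + S 1 * S 1 * star (S 1)
              - S 1 * S 0 * star (S 0) - S 0 * S 1 * star (S 1)) ->
  cuntz_relations T.
Proof.
move=> SP T0 T1; have [hh _ h2] := isqrt2 h erefl.
pose V := S 0 * star (S 0) - S 1 * star (S 1).
have Vs : star V = V by rewrite starB !starM !starK.
have dotE v w v' w' : (v * star w) * (v' * w') = v * (star w * v') * w'.
  by rewrite !mulrA.
have VV : V * V = 1.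
  rewrite -(cuntz_sum1 S SP) mulrBl !mulrBr !dotE !cuntz_starM //.
  by rewrite !mulr0 !mul0r !mulr1 subr0 sub0r opprK.
have T0v : T 0 = cuntz_vec S h h by rewrite T0 /cuntz_vec scalerDr.
have T1v : T 1 = cuntz_vec S h (- h) * V by rewrite T1 masa_S1_factor.
split=> [i|].
  case: (ord2P i) => ->.
    by rewrite T0v star_cuntz_vecM // /cdot hh h2 scale1r.
  rewrite T1v starM mulrA -(mulrA (star V)) star_cuntz_vecM // /cdot.
  by rewrite rmorphN /= hh mulrNN h2 scale1r mulr1 Vs VV.
rewrite sum_ord2 T1v starM Vs mulrA -(mulrA _ V V) VV mulr1 T0v.
rewrite /cuntz_vec scaleNr starB starD !starZ hh.
have para (p q r s : A) :
    (p + q) * (r + s) + (p - q) * (r - s) = (p * r + p * r) + (q * s + q * s).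
  rewrite !mulrDl !mulrDr !mulNr !mulrN opprK addrACA.
  by rewrite (addrACA (p * r)) subrr addr0 (addrACA (q * r)) subrr add0r.
rewrite para -!scalerAl -!scalerAr !scalerA.
by rewrite -!(scalerDl _ (h * h)) h2 !scale1r cuntz_sum1.
Qed.

Lemma masa_unitary_in_F2 {R : realType} {A : cstarAlgType R} (S : 'I_2 -> A)
    (T : 'I_2 -> A) (h : R[i]) :
  cuntz_relations S -> T 0 = h *: (S 0 + S 1) ->
  T 1 = h *: (S 0 * S 0 * star (S 0) + S 1 * S 1 * star (S 1)
              - S 1 * S 0 * star (S 0) - S 0 * S 1 * star (S 1)) ->
  cuntz_F S 2 (T 0 * star (S 0) + T 1 * star (S 1)).
Proof.
move=> SP T0 T1.
pose m i j k l := S i * S j * star (S k) * star (S l).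
have mF i j k l : cuntz_F S 2 (m i j k l).
  (* The second word is reversed because [star] reverses products. *)
  have := cuntz_F_word S 2 [tuple i; j] [tuple l; k].
  by rewrite /cuntz_word !big_cons !big_nil !mulr1 starM /m !mulrA.
have F0 : cuntz_F S 2 0.
  by have := cuntz_F_lin S 2 (-1) _ _ (mF 0 0 0 0) (mF 0 0 0 0);
    rewrite scaleN1r addNr.
have FZ c x : cuntz_F S 2 x -> cuntz_F S 2 (c *: x).
  by move=> Fx; rewrite -[_ *: _]addr0; exact: cuntz_F_lin.
have FD x y : cuntz_F S 2 x -> cuntz_F S 2 y -> cuntz_F S 2 (x + y).
  by move=> Fx Fy; rewrite -[x]scale1r; exact: cuntz_F_lin.
have FN x : cuntz_F S 2 x -> cuntz_F S 2 (- x).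
  by move=> Fx; rewrite -scaleN1r; exact: FZ.
rewrite T0 T1 -!scalerAl; apply: (FD); apply: FZ.
  (* This summand has words of length 1; inserting [Q_0 + Q_1] lengthens them to 2. *)
  rewrite -[S 0 + S 1]mulr1 -(cuntz_sum1 S SP) mulrDl !mulrDr !mulrDl !mulrA.
  by apply: (FD); apply: (FD); exact: mF.
rewrite !mulrDl !mulNr.
by apply: (FD); [apply: (FD); [apply: (FD)|]|]; try apply: (FN); exact: mF.
Qed.

(** * Existence of [lambda], and the contradiction from an invariant standard MASA *)

Theorem mainTheorem6 (R : realType) (A : cstarAlgType R) (S : 'I_2 -> A)
    (hS : cuntz_algebra S) :
  (exists lam : {lrmorphism A -> A}, masa_endo_spec S lam) /\
  forall lam : {lrmorphism A -> A}, masa_endo_spec S lam ->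
    let u := lam (S 0) * star (S 0) + lam (S 1) * star (S 1) in
    [/\ unitary u,
        cuntz_F S 2 u
      & ~ exists M : set A, standard_masa hS M /\ lam @` M `<=` M].
Proof.
have SP := cuntz_rel hS; split.
  pose T (i : 'I_2) : A := if i == 0 then (sqrtC 2)^-1 *: (S 0 + S 1) else
    (sqrtC 2)^-1 *: (S 0 * S 0 * star (S 0) + S 1 * S 1 * star (S 1)
         - S 1 * S 0 * star (S 0) - S 0 * S 1 * star (S 1)).
  have TP : cuntz_relations T by exact: (masa_relations S).
  have [f [fs fT]] := cuntz_univ hS TP.
  by exists f; split; rewrite // fT.
move=> lam [lams lam0 lam1] u; split.
- have lamP := star_morphism_relations S lam lams SP.
  exact: (cuntz_relations_unitary S (lam \o S) SP lamP).
- exact: (masa_unitary_in_F2 S (lam \o S) _ SP lam0 lam1).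
move=> [M [[z [hz [zF ->]]] lamM]].
have [Ls LS] := cuntz_endoP hS hz; set L := cuntz_endo hS hz in Ls LS lamM.
have [a [b zS0]] := cuntz_F1_gen S SP z 0 zF.
have [hh h0 _] := @isqrt2 R _ erefl.
set h := (sqrtC 2)^-1 in lam0 lam1 hh h0.
pose T0 := cuntz_vec S a b; pose P := T0 * star T0.
have LT : L (S 0) = T0 by rewrite LS.
have LP : L (S 0 * star (S 0)) = P by rewrite rmorphM /= Ls LT.
have n1 : cdot a b a b = 1.
  have := (star_morphism_relations S L Ls SP).1 0.
  rewrite /= LT star_cuntz_vecM // -[RHS]scale1r => /eqP.
  by rewrite -subr_eq0 -scalerBl scaler_eq0 oner_eq0 orbF subr_eq0 => /eqP.
have nT : star T0 * T0 = 1 by rewrite star_cuntz_vecM // n1 scale1r.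
pose f := lam T0; pose E := f * star f.
(* [P] is the image under [L] of [Q_0], so invariance puts [E = lambda(P)] in the MASA. *)
have [d Dd Ld] : (L @` cuntz_D S) E.
  apply: lamM; exists P; last by rewrite rmorphM /= lams.
  exists (S 0 * star (S 0)) => // D [_]; apply.
  by exists [:: 0]; rewrite // /cuntz_word big_seq1.
have EP : E * P = P * E.
  rewrite -Ld -LP -!rmorphM; congr (L _).
  by have := cuntz_D_comm S SP d [:: 0] Dd; rewrite /= /cuntz_word big_seq1.
have EPP : E * (T0 * P * star T0) = (T0 * P * star T0) * E.
  rewrite -Ld -LP -LT -Ls -!rmorphM; congr (L _).
  have := cuntz_D_comm S SP d [:: 0; 0] Dd.
  by rewrite /= /cuntz_word !big_cons big_nil mulr1 starM !mulrA.
have lin r s r' s' : a *: cuntz_vec S r s + b *: cuntz_vec S r' s' =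
    cuntz_vec S (a * r + b * r') (a * s + b * s').
  by rewrite /cuntz_vec !scalerDr !scalerA addrACA -!scalerDl.
have lam0v : lam (S 0) = cuntz_vec S h h by rewrite lam0 scalerDr.
rewrite masa_S1_factor in lam1.
pose gp := cuntz_vec S (h * (a + b)) (h * (a - b)).
pose gm := cuntz_vec S (h * (a - b)) (h * (a + b)).
have fE : f = a *: lam (S 0) + b *: lam (S 1).
  by rewrite /f /T0 /cuntz_vec rmorphD /= !linearZ.
(* [Q_0 - Q_1] fixes [S 0] and negates [S 1], whence the sign difference between [gp] and [gm]. *)
have f0 : f * S 0 = gp * S 0.
  rewrite fE mulrDl -!scalerAl lam1 -mulrA mulrBl -!mulrA !cuntz_starM // mulr0.
  rewrite subr0 mulr1 lam0v !scalerAl -mulrDl lin.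
  by congr (cuntz_vec S _ _ * _); ring.
have f1 : f * S 1 = gm * S 1.
  rewrite fE mulrDl -!scalerAl lam1 -mulrA mulrBl -!mulrA !cuntz_starM // mulr0.
  rewrite sub0r mulr1 mulrN -mulNr lam0v !scalerAl -mulrDl.
  have -> : - cuntz_vec S h (- h) = cuntz_vec S (- h) h.
    by rewrite /cuntz_vec opprD scaleNr opprK scaleNr.
  by rewrite lin; congr (cuntz_vec S _ _ * _); ring.
have EE := cuntz_conj_split S SP f gp gm f0 f1.
have comp a' b' c' d' := cuntz_compress S SP a' b' c' d' _ _ _ _ _ EE.
have alg_inj (c c' : R[i]) : c%:A = c'%:A :> A -> c = c'.
  move=> /eqP; rewrite -subr_eq0 -scalerBl scaler_eq0 oner_eq0 orbF subr_eq0.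
  by move=> /eqP.
apply: (masa_coeff_absurd a b h hh h0 n1).
  (* The pair [(- conjc b, conjc a)] is orthogonal to [T0], while [E T0 = P E T0] is a left multiple
     of [T0]. *)
  have T10 : star (cuntz_vec S (- conjc b) (conjc a)) * T0 = 0.
    by rewrite star_cuntz_vecM // /cdot rmorphN /= !conjcK mulNr mulrC
      addNr scale0r.
  have := comp (- conjc b) (conjc a) a b.
  have -> : star (cuntz_vec S (- conjc b) (conjc a)) * E * T0 = 0.
    have -> : T0 = P * T0 by rewrite /P -mulrA nT mulr1.
    by rewrite -mulrA (mulrA E) EP /P !mulrA T10 !mul0r.
  (* This isolates the coefficient of [Q_1]. *)
  move=> /(congr1 (fun x => star (S 1) * x * S 1)) /esym.
  rewrite mulr0 mul0r mulrDr mulrDl -!scalerAr -!scalerAl !mulrA.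
  rewrite !cuntz_starM // !mul0r scaler0 add0r mul1r cuntz_starM //.
  by rewrite -(scale0r (1 : A)) => /alg_inj.
have XP : star T0 * E * T0 * P = P * (star T0 * E * T0).
  transitivity (star T0 * (E * (T0 * P * star T0)) * T0).
    by rewrite -!mulrA nT mulr1.
  by rewrite EPP !mulrA nT mul1r.
have TS1 : star T0 * S 1 = (conjc b)%:A.
  by rewrite {1}cuntz_gen_vec star_cuntz_vecM // /cdot mulr0 add0r mulr1.
have ST0 : star (S 0) * T0 = a%:A.
  by rewrite {1}cuntz_gen_vec star_cuntz_vecM // /cdot conjc1 conjc0
    mul0r addr0 mul1r.
have SPS : star (S 0) * P * S 1 = (a * conjc b)%:A.
  by rewrite /P mulrA ST0 -mulrA TS1 -scalerAl mul1r scalerA.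
rewrite /P !mulrA in SPS.
(* Compare the off-diagonal entries of the two products: [P] contributes [a * conjc b] to each, and
   the compression its [Q_0] coefficient on the left, its [Q_1] coefficient on the right. *)
move: XP; rewrite comp => /(congr1 (fun x => star (S 0) * x * S 1)).
have lefth r s :
    star (S 0) * (r *: (S 0 * star (S 0)) + s *: (S 1 * star (S 1))) =
    r *: star (S 0).
  by rewrite mulrDr -!scalerAr !mulrA !cuntz_starM // mul1r mul0r scaler0 addr0.
have righth r s : (r *: (S 0 * star (S 0)) + s *: (S 1 * star (S 1))) * S 1
    = s *: S 1.
  rewrite mulrDl -!scalerAl -!mulrA !cuntz_starM //.
  by rewrite mulr1 mulr0 scaler0 add0r.
rewrite mulrA lefth -!mulrA righth -scalerAl -!scalerAr !mulrA SPS !scalerA.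
by move/alg_inj; rewrite !mulrA.
Qed.
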